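(* For each compact metric space $X$, $\dim_S X\ge\overline{\dim}_B X$, where $\dim_S$ is the spectral dimension and $\overline{\dim}_B$ the upper box dimension.
   Context: $|xy|$ is the distance in $X$; $\Delta\subset X^2$ is the diagonal; for $z=(x,y)\in X^2$, $|z|=|xy|$; $X^2$ carries the metric $|zz'|=\max\{|xx'|,|yy'|\}$. Spectral geometry (in the concrete form to which every axiomatically defined one is isomorphic): a triple $M=M(B,m)=\{\mathcal A,\mathcal H,ds\}$ where $B\subset X^2\setminus\Delta$ (the support) is symmetric under $(y,y')\mapsto(y',y)$ and $\{b\in B:|b|\ge t\}$ is finite for each $t>0$; $m:B\to\mathbb N$ is a symmetric function; $\mathcal H$ consists of square-summable sections $\xi$ on $B$, $\xi(y,y')\in\mathbb C^{m(y,y')}$; $\mathcal A$ is the algebra of Lipschitz functions on $X$ acting by $(\pi(a)\xi)(y,y')=a(y)\xi(y,y')$; $(ds\,\xi)(y,y')=|yy'|\xi(y',y)$. Local density: $\mathrm{dens}_{\mathrm{loc}}(M)=\lim_{t\to0}\ \inf_{z\in X^2\setminus\Delta,\,|z|\le t}\ \sup_{b\in B}|z|/|zb|$, with $|z|/0=\infty$, $\inf\emptyset=\infty$. Dixmier trace: $\omega$ is a fixed generalized limit (dilation-invariant state on bounded sequences extending the ordinary limit). For positive bounded diagonalizable $T$ with eigenvalues $\mu_0\ge\mu_1\ge\dots$ (with multiplicity, padded by zeros), $\sigma_N(T)=\sum_{n<N}\mu_n$; $\mathrm{Tr}_\omega(T)=\lim_\omega\sigma_N(T)/\log N$ if $\sigma_N(T)/\log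 N$ is bounded, $\infty$ otherwise. Dimension of $M$: $\dim M=\sup\{p\ge0:\mathrm{Tr}_\omega(|ds|^p)=\infty\}=\inf\{p\ge0:\mathrm{Tr}_\omega(|ds|^p)=0\}$ (with $\sup\emptyset=0$, $\inf\emptyset=\infty$; the two coincide). Spectral dimension: $\dim_S X=\liminf\{\dim M:\mathrm{dens}_{\mathrm{loc}}(M)\to\infty\}$, i.e. $\lim_{D\to\infty}\inf\{\dim M: M \text{ a spectral geometry on }X,\ \mathrm{dens}_{\mathrm{loc}}(M)\ge D\}$. Upper box dimension: $\overline{\dim}_BX=\limsup_{t\to0}\log N_t(X)/\log t^{-1}$, where $N_t(X)$ is the least number of sets of diameter $\le2t$ needed to cover $X$. *)

(* Defs.v *)
From HB Require Import structures.
From mathcomp Require Import all_boot all_order all_algebra.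
From mathcomp Require Import all_classical all_reals all_analysis.
From mathcomp.real_closed Require Import complex.

Set Implicit Arguments.
Unset Strict Implicit.
Unset Printing Implicit Defensive.

Import Order.TTheory GRing.Theory Num.Theory.
Import numFieldNormedType.Exports.
Import ComplexField.Normc.

Local Open Scope classical_set_scope.
Local Open Scope ring_scope.
Local Open Scope complex_scope.

Definition swap (X : Type) (z : X * X) : X * X := (z.2, z.1).

Definition len (R : realType) (X : metricType R) (z : X * X) : R :=
  mdist z.1 z.2.

Definition dist2 (R : realType) (X : metricType R) (z w : X * X) : R :=
  Num.max (mdist z.1 w.1) (mdist z.2 w.2).

(* The multiplicity is extended by 0 off the support and is positive on it,
   so a section over X * X with fibre C^(mult z) is the same thing as a section
   over the support. *)
Record spectral_geometry (R : realType) (X : metricType R) := SpectralGeometry {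
  supp : set (X * X);
  mult : X * X -> nat;
  supp_offdiag : forall x : X, ~ supp (x, x);
  supp_sym : forall z, supp z -> supp (swap z);
  supp_finite : forall t : R, 0 < t -> finite_set [set b | supp b /\ t <= len b];
  mult_gt0 : forall z, (0 < mult z)%N <-> supp z;
  mult_sym : forall z, mult (swap z) = mult z
}.

Definition section (R : realType) (X : metricType R)
    (M : spectral_geometry X) : Type :=
  forall z : X * X, 'rV[R[i]]_(mult M z).

Definition sqnorm (R : realType) (X : metricType R) (M : spectral_geometry X)
    (xi : section M) : \bar R :=
  \esum_(z in supp M) (\sum_(k < mult M z) normc (xi z ord0 k) ^+ 2)%:E.

Definition hilbert (R : realType) (X : metricType R) (M : spectral_geometry X)
    : set (section M) :=
  [set xi | (sqnorm xi < +oo)%E].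

Definition operator (R : realType) (X : metricType R)
    (M : spectral_geometry X) : Type := section M -> section M.

(* The algebra and its representation belong to the triple (A, H, ds), but
   neither the density nor the dimension refers to them. *)
Definition lipschitz_algebra (R : realType) (X : metricType R)
    : set (X -> R[i]) :=
  [set a | exists L : R, forall x y, normc (a x - a y) <= L * mdist x y].

Definition rep (R : realType) (X : metricType R) (M : spectral_geometry X)
    (a : X -> R[i]) : operator M :=
  fun xi z => a z.1 *: xi z.

(* [castmx] transports the fibre C^(m(y',y)) to C^(m(y,y')). *)
Definition ds (R : realType) (X : metricType R) (M : spectral_geometry X)
    : operator M :=
  fun xi z =>
    (len z)%:C *: castmx (erefl 1%N, mult_sym M z) (xi (swap z)).

Definition bounded_linear (R : realType) (X : metricType R)
    (M : spectral_geometry X) (T : operator M) : Prop :=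
  [/\ forall xi, hilbert xi -> hilbert (T xi),
      forall (a : R[i]) xi eta, hilbert xi -> hilbert eta ->
        forall z, T (fun w => a *: xi w + eta w) z = a *: T xi z + T eta z
    & exists C : R, forall xi, hilbert xi ->
        (sqnorm (T xi) <= C%:E * sqnorm xi)%E].

Definition eigenspace_at (R : realType) (X : metricType R)
    (M : spectral_geometry X) (T : operator M) (lam : R[i])
    : set (section M) :=
  [set xi | hilbert xi /\ forall z, T xi z = lam *: xi z].

(* For a diagonalizable self-adjoint D, |D|^p is the bounded operator acting as
   |lam|^p on the lam-eigenspace of D (functional calculus); as the eigenvectors
   of D are total, this determines it on the Hilbert space. *)
Definition is_abs_pow (R : realType) (X : metricType R)
    (M : spectral_geometry X) (D : operator M) (p : R) (T : operator M)
    : Prop :=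
  bounded_linear T /\
  forall (lam : R[i]) xi, eigenspace_at D lam xi ->
    eigenspace_at T (normc lam `^ p)%:C xi.

Definition abs_pow (R : realType) (X : metricType R)
    (M : spectral_geometry X) (D : operator M) (p : R) : operator M :=
  xget (idfun : {classic operator M}) [set T | is_abs_pow D p T].

Definition lin_indep (R : realType) (X : metricType R)
    (M : spectral_geometry X) (n : nat) (v : 'I_n -> section M) : Prop :=
  forall c : 'I_n -> R[i],
    (forall z, \sum_i c i *: v i z = 0) -> forall i, c i = 0.

(* The eigenvalues that are >= lam, counted with multiplicity, number at
   least n. *)
Definition eigen_count_ge (R : realType) (X : metricType R)
    (M : spectral_geometry X) (T : operator M) (lam : R) (n : nat) : Prop :=
  exists (l : 'I_n -> R) (v : 'I_n -> section M),
    (forall i, lam <= l i /\ eigenspace_at T (l i)%:C (v i)) /\ lin_indep v.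

(* mu_n for a positive bounded diagonalizable T: the largest lam such that more
   than n eigenvalues are >= lam.  When T has at most n eigenvalues (with
   multiplicity) the set is empty and [sup] returns 0, which is the padding. *)
Definition eigenvalue_seq (R : realType) (X : metricType R)
    (M : spectral_geometry X) (T : operator M) (n : nat) : R :=
  sup [set lam : R | 0 <= lam /\ eigen_count_ge T lam n.+1].

Definition bounded_seq (R : realType) (u : nat -> R) : Prop :=
  exists C : R, forall n, `|u n| <= C.

(* Dilation invariance is invariance under every
   u |-> (u_0, .., u_0, u_1, .., u_1, ...), each term being repeated k times. *)
Record generalized_limit (R : realType) (omega : (nat -> R) -> R) : Prop := {
  gl_linear : forall (a : R) u v, bounded_seq u -> bounded_seq v ->
    omega (fun n => a * u n + v n) = a * omega u + omega v;
  gl_ge0 : forall u, bounded_seq u -> (forall n, 0 <= u n) -> 0 <= omega u;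
  gl_lim : forall (u : nat -> R) (l : R), u @ \oo --> l -> omega u = l;
  gl_dilation : forall (k : nat) u, (0 < k)%N -> bounded_seq u ->
    omega (fun n => u (n %/ k)%N) = omega u
}.

Definition sigma (R : realType) (X : metricType R)
    (M : spectral_geometry X) (T : operator M) (N : nat) : R :=
  \sum_(n < N) eigenvalue_seq T n.

(* The quotient is 0 for N = 0, 1, as [ln 0 = ln 1 = 0] and [x / 0 = 0]. *)
Definition log_mean (R : realType) (X : metricType R)
    (M : spectral_geometry X) (T : operator M) (N : nat) : R :=
  sigma T N / ln N%:R.

Definition dixmier_trace (R : realType) (omega : (nat -> R) -> R)
    (X : metricType R) (M : spectral_geometry X) (T : operator M) : \bar R :=
  if `[< bounded_seq (log_mean T) >] then (omega (log_mean T))%:E else +oo%E.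

(* The supremum is taken in [0, +oo], whence the extra element 0. *)
Definition dimension (R : realType) (omega : (nat -> R) -> R)
    (X : metricType R) (M : spectral_geometry X) : \bar R :=
  ereal_sup ([set 0%E] `|`
    [set p%:E | p in [set p : R |
       0 <= p /\ dixmier_trace omega (abs_pow (@ds R X M) p) = +oo%E]]).

Definition len_ratio (R : realType) (X : metricType R) (z b : X * X) : \bar R :=
  if dist2 z b == 0 then +oo%E else (len z / dist2 z b)%:E.

(* As above, the supremum is taken in [0, +oo]. *)
Definition local_density (R : realType) (X : metricType R)
    (M : spectral_geometry X) : \bar R :=
  lim ((ereal_inf
          [set ereal_sup ([set 0%E] `|` [set len_ratio z b | b in supp M])
             | z in [set z : X * X | z.1 <> z.2 /\ len z <= t]])
       @[t --> (0 : R)^'+]).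

Definition spectral_dimension (R : realType) (omega : (nat -> R) -> R)
    (X : metricType R) : \bar R :=
  lim ((ereal_inf
          [set dimension omega M
             | M in [set M : spectral_geometry X |
                       (D%:E <= local_density M)%E]])
       @[D --> (+oo%R : set_system R)]).

Definition covers_by (R : realType) (X : metricType R) (t : R) (n : nat)
    : Prop :=
  exists A : 'I_n -> set X,
    (forall i x y, A i x -> A i y -> mdist x y <= 2 * t) /\
    [set: X] `<=` \bigcup_i A i.

(* The infimum, over a set of naturals, is attained; it is finite for t > 0 and
   X compact. *)
Definition covering_number (R : realType) (X : metricType R) (t : R) : \bar R :=
  ereal_inf [set n%:R%:E | n in [set n : nat | covers_by X t n]].

Definition upper_box_dimension (R : realType) (X : metricType R) : \bar R :=
  limf_esup (fun t : R => (lne (covering_number X t) / (ln t^-1)%:E)%E)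
    (0 : R)^'+.

(* Main.v *)
(* For p < q < dim_B X there are arbitrarily small t with N_t >= t^-q, hence
   t-separated sets of at least t^-q points.  If the local density of M exceeds
   10, all but boundedly many points of such a set have their own element b of
   the support with |b| >= t/2.  So |ds|^p has at least n = t^-q - O(1)
   eigenvalues >= (t/2)^p, and sigma_n >= n (t/2)^p outgrows every multiple of
   log n: the Dixmier trace of |ds|^p is infinite and p <= dim M. *)
Require Import Defs.
From mathcomp Require Import all_boot all_order all_algebra.
From mathcomp Require Import all_classical all_reals all_analysis.
From mathcomp Require Import ring lra.
From mathcomp.real_closed Require Import complex.

Set Implicit Arguments.
Unset Strict Implicit.
Unset Printing Implicit Defensive.

Import Order.TTheory GRing.Theory Num.Theory.
Import numFieldNormedType.Exports.
Import ComplexField.Normc.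

Local Open Scope classical_set_scope.
Local Open Scope ring_scope.

(** * Separated sets, covers and the support of a dense geometry *)

Definition separated (R : realType) (X : metricType R) (t : R) (s : seq X) :
  bool := pairwise (fun x y => t < mdist x y) s.

(** Compactness in near-covering form: along the filter of finite sequences ordered by inclusion,
    what eventually holds near each point eventually holds everywhere at once. *)
Lemma compact_net (R : realType) (X : metricType R) (e : R) :
  compact [set: X] -> 0 < e ->
  exists s : seq X, forall x, exists2 y, y \in s & mdist y x < e.
Proof.
move=> cX e0.
pose F := filter_from [set: seq X] (fun s => [set s' : seq X | {subset s <= s'}]).
have FF : Filter F.
  apply: filter_from_filter; first by exists [::].
  move=> s1 s2 _ _; exists (s1 ++ s2) => // s' s12; split=> x xs; apply: s12.
    by rewrite mem_cat xs.
  by rewrite mem_cat xs orbT.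
pose P (s : seq X) (x : X) := exists2 y, y \in s & mdist y x < e.
have [x _|s _ /(_ s (fun _ => id)) sP] :=
    (compact_near_coveringP _).1 cX _ F P FF.
  exists (ball x e, [set s : seq X | x \in s]) => [|[x' s] [/= + xs]].
    by split; [exact: nbhsx_ballx|exists [:: x] => // s; apply; rewrite mem_head].
  by rewrite ballEmdist => xx'; exists x.
by exists s => x; exact: sP.
Qed.

(** Sending each point to a net point within t/2 is injective on a separated sequence. *)
Lemma separated_size_bound (R : realType) (X : metricType R) (t : R) :
  compact [set: X] -> 0 < t ->
  exists K : nat, forall s : seq X, separated t s -> (size s <= K)%N.
Proof.
move=> cX t0; have [|s0 hs0] := compact_net cX (e := t / 2); first by lra.
have /choice[c cP] : forall x, exists y, y \in s0 /\ mdist y x < t / 2.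
  by move=> x; have [y] := hs0 x; exists y.
exists (size s0) => s hs; rewrite -(size_map c s).
apply: uniq_leq_size => [|_ /mapP[x _ ->]]; last by have [] := cP x.
rewrite uniq_pairwise pairwise_map; apply: sub_pairwise hs => x y /= xy.
apply/eqP => cxy; have [_ cx] := cP x; have [_ cy] := cP y.
rewrite -cxy in cy; have := metric_triangle x (c x) y.
by rewrite (metric_sym x (c x)); lra.
Qed.

(** A separated sequence of maximal size works: a point outside the closed t-balls around its
    members could be added to it. *)
Lemma separated_covers (R : realType) (X : metricType R) (t : R) :
  compact [set: X] -> 0 < t ->
  exists2 s : seq X, separated t s & covers_by X t (size s).
Proof.
move=> cX t0; have [K hK] := separated_size_bound cX t0.
pose P n := `[< exists2 s : seq X, separated t s & size s = n >].
have P0 : exists n, P n by exists 0%N; apply/asboolP; exists [::].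
have PK n : P n -> (n <= K)%N by move=> /asboolP[s /hK sK <-].
have [n /asboolP[s ss sn] nmax] := ex_maxnP P0 PK; exists s => //.
exists (fun i => [set x | mdist (tnth (in_tuple s) i) x <= t]); split.
  move=> i x y /=; set c := tnth _ _ => cx cy.
  by have := metric_triangle x c y; rewrite (metric_sym x c); lra.
move=> x _; case: (boolP (all (fun y => t < mdist x y) s)) => [xs|].
  suff : (n.+1 <= n)%N by rewrite ltnn.
  by apply: nmax; apply/asboolP; exists (x :: s); rewrite /= ?sn// /separated /= xs.
rewrite -has_predC => /hasP[y /(nthP x)[i si <-]] /=; rewrite -leNgt metric_sym => xy.
by exists (Ordinal si) => //=; rewrite (tnth_nth x).
Qed.

Lemma nearest_point (R : realType) (X : metricType R) (x : X) (s : seq X) :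
  s != [::] ->
  exists2 y, y \in s & forall z, z \in s -> mdist x y <= mdist x z.
Proof.
elim: s => // a [_ _|b s /(_ isT)[y ys ymin] _].
  by exists a; rewrite ?mem_head // => z; rewrite inE => /eqP ->.
have [ay|ya] := leP (mdist x a) (mdist x y).
  exists a; rewrite ?mem_head // => z; rewrite inE => /predU1P[-> //|zs].
  exact: le_trans ay (ymin z zs).
exists y; first by rewrite inE ys orbT.
by move=> z; rewrite inE => /predU1P[->|/ymin //]; exact: ltW.
Qed.

(* Adding the points of s one at a time, the pair z formed by a point and its
   nearest predecessor is approximated by some b in B with |zb| <= |z|/10.
   Different points get different b's: the first coordinate of b is much closer
   to the new point than that point is to its predecessors. *)
Lemma separated_support (R : realType) (X : metricType R) (B : set (X * X))
    (t0 t : R) (s : seq X) :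
  0 < t ->
  (forall z : X * X, z.1 <> z.2 -> len z <= t0 ->
    exists2 b, B b & 10 * dist2 z b <= len z) ->
  separated t s ->
  exists (bs : seq (X * X)) (us : seq X),
    [/\ uniq bs, forall b, b \in bs -> B b /\ t / 2 <= len b,
        separated t0 us & size s = (size bs + size us)%N].
Proof.
move=> t_gt0 dense ss.
(* Strengthened for the induction: the first coordinate of each [b] is within |b|/8 of a point of
   [s], which keeps later pairs distinct from it. *)
suff [bs [us [H1 H2 H3 _ H5]]] : exists (bs : seq (X * X)) (us : seq X),
    [/\ uniq bs,
        forall b, b \in bs -> [/\ B b, t / 2 <= len b &
          exists2 x, x \in s & mdist x b.1 <= len b / 8],
        separated t0 us, {subset us <= s}
      & size s = (size bs + size us)%N].
  by exists bs, us; split=> // b /H2[].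
elim: s ss => [_|x s IH /= /andP[xs /IH[bs [us [ubs bsP sus us_s sz]]]]].
  by exists [::], [::]; split.
(* A point farther than [t0] from all of [s] goes into [us], since the density hypothesis does not
   reach its pairs with [s]. *)
case: (boolP (all (fun y => t0 < mdist x y) s)) => [far|].
  exists bs, (x :: us); split=> //.
  - move=> b /bsP[Bb tb [y ys yb]]; split=> //.
    by exists y => //; rewrite inE ys orbT.
  - by apply/andP; split=> //; apply/allP => y /us_s; exact: (allP far).
  - move=> y; rewrite !inE => /predU1P[->|/us_s ->]; first by rewrite eqxx.
    by rewrite orbT.
  - by rewrite /= addnS sz.
rewrite -has_predC => /hasP[w ws]; rewrite /= -leNgt => xw.
have [|y ys ymin] := @nearest_point _ _ x s; first by case: (s) ws.
have txy := allP xs _ ys.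
have [||b Bb] := dense (x, y).
- by move=> /= xy; move: txy; rewrite xy mdistxx; lra.
- exact: le_trans (ymin _ ws) xw.
rewrite /dist2 /len /= => hb.
have h1 : mdist x b.1 <= mdist x y / 10.
  have : mdist x b.1 <= Num.max (mdist x b.1) (mdist y b.2) by rewrite le_max lexx.
  by lra.
have h2 : mdist y b.2 <= mdist x y / 10.
  have : mdist y b.2 <= Num.max (mdist x b.1) (mdist y b.2) by rewrite le_max lexx orbT.
  by lra.
(* With |b| between 0.8|xy| and 1.2|xy|, both |b| >= t/2 and |xy|/10 <= |b|/8 follow. *)
have lb : 8 / 10 * mdist x y <= mdist b.1 b.2.
  have := metric_triangle x b.1 y; have := metric_triangle b.1 b.2 y.
  by rewrite (metric_sym b.2 y); lra.
have ub : mdist b.1 b.2 <= 12 / 10 * mdist x y.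
  have := metric_triangle b.1 x b.2; have := metric_triangle x y b.2.
  by rewrite (metric_sym b.1 x); lra.
exists (b :: bs), us; split=> //.
(* Were [b] already listed, some [x'] in [s] would be within (0.1 + 0.15)|xy| of [x], closer than
   the nearest point [y]. *)
- rewrite /= ubs andbT; apply/negP => /bsP[_ _ [x' x's]]; rewrite /len => h3.
  have := ymin _ x's; have := metric_triangle x b.1 x'.
  by rewrite (metric_sym b.1 x'); lra.
- move=> b'; rewrite inE => /predU1P[->|/bsP[Bb' tb' [x' x's x'b]]].
    by split=> //; [rewrite /len; lra | exists x; rewrite ?mem_head // /len; lra].
  by split=> //; exists x' => //; rewrite inE x's orbT.
- by move=> z /us_s zs; rewrite inE zs orbT.
- by rewrite /= addSn sz.
Qed.

(** * Exponential growth against the logarithm *)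

(** Meant for u = ln(1/t). Split n = n^a n^(1-a) with a = (q-p)/(2q): n^a absorbs C ln n up to a
    constant, and n^(1-a) outgrows exp(pu) because (1-a)q = (p+q)/2 > p. *)
Lemma power_beats_log (R : realType) (p q C : R) (K : nat) :
  0 <= p -> p < q ->
  exists U : R, forall (u : R) (n : nat), U < u ->
    expR (q * u) <= n%:R + K%:R ->
    1 < n%:R :> R /\ C * ln n%:R < n%:R * expR (- (p * (u + ln 2))).
Proof.
move=> p0 pq; have q0 : 0 < q by lra.
have [l2_gt0 l2_lt1] : 0 < ln (2 : R) /\ ln (2 : R) < 2.
  by split; [rewrite ln_gt0 //; lra | apply: ln_sublinear; lra].
pose a := (q - p) / (2 * q).
have a0 : 0 < a by rewrite divr_gt0 //; lra.
have aq : a * q = (q - p) / 2 by rewrite /a; field; lra.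
have a1 : a < 1 by rewrite ltr_pdivrMr; lra.
pose B : R := (`|C| + 1) / a.
have B0 : 0 < B by rewrite divr_gt0 // ltr_wpDl.
pose c0 := ln B + (1 - a) * ln 2 + p * ln 2.
(* The first summand forces qu > 4 + 2K, hence n >= exp(qu)/2 and n > 1; the second forces u(q-p)/2
   > [c0], the total of the constants. *)
exists ((4 + 2 * K%:R) / q + `|c0| / ((q - p) / 2)) => u n.
have K0 : 0 <= K%:R :> R by [].
have h1 : 0 <= (4 + 2 * K%:R) / q by rewrite divr_ge0 //; lra.
have h2 : 0 <= `|c0| / ((q - p) / 2) by rewrite divr_ge0 //; lra.
move=> uU en.
have h3 : 4 + 2 * K%:R < q * u by rewrite [q * u]mulrC -ltr_pdivrMr //; lra.
have h4 : c0 < u * ((q - p) / 2).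
  by apply: (le_lt_trans (ler_norm c0)); rewrite -ltr_pdivrMr; lra.
have eqge := expR_ge1Dx (q * u).
have n2 : expR (q * u) / 2 <= n%:R by lra.
have n1 : 1 < n%:R :> R by lra.
split=> //.
have n0 : 0 < n%:R :> R by lra.
have nE : n%:R = expR (ln n%:R) :> R by rewrite lnK // posrE.
have Lge : q * u - ln 2 <= ln n%:R.
  by rewrite -ler_expR -nE expRD expRN [expR (ln 2)]lnK // posrE.
move: nE Lge; set L := ln _ => nE Lge.
have L0 : 0 < L by rewrite ln_gt0.
have aL : a * L < expR (a * L) by have := expR_ge1Dx (a * L); lra.
have : C * L < B * expR (a * L).
  apply: (@le_lt_trans _ _ (`|C| * L)); first by rewrite ler_wpM2r ?ler_norm //; lra.
  apply: (@lt_trans _ _ ((`|C| + 1) * L)); first by lra.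
  have -> : (`|C| + 1) * L = B * (a * L) by rewrite /B; field; lra.
  by rewrite ltr_pM2l.
move=> /lt_le_trans; apply.
rewrite nE -expRD -[X in X * _](lnK B0) -expRD ler_expR.
have : (1 - a) * (q * u - ln 2) <= (1 - a) * L by rewrite ler_wpM2l //; lra.
by move: h4; rewrite /c0; nra.
Qed.

(** * Scaling of infinite sums, moduli and the swap *)

(** The inequality [le], used for c and again for its inverse, gives both directions. *)
Lemma esumZl (R : realType) (T : choiceType) (A : set T) (f : T -> \bar R)
    (c : R) : 0 <= c -> (forall x, (0 <= f x)%E) ->
  \esum_(x in A) (c%:E * f x)%E = (c%:E * \esum_(x in A) f x)%E.
Proof.
move=> c0 f0.
have le k (g : T -> \bar R) : 0 <= k -> (forall x, (0 <= g x)%E) ->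
    (\esum_(x in A) (k%:E * g x) <= k%:E * \esum_(x in A) g x)%E.
  move=> k0 g0; apply: ge_ereal_sup => _ [F FA <-].
  rewrite -ge0_mule_fsumr //; apply: lee_wpmul2l; first by rewrite lee_fin.
  by apply: esum_ge; exists F.
apply/eqP; rewrite eq_le le //=.
have [->|c_neq0] := eqVneq c 0.
  by rewrite mul0e; apply: esum_ge0 => x _; rewrite mul0e.
have {c_neq0} c_gt0 : 0 < c by rewrite lt_neqAle eq_sym c_neq0.
rewrite -lee_pdivlMl //.
have -> : \esum_(x in A) f x = \esum_(x in A) (c^-1%:E * (c%:E * f x))%E.
  by apply: eq_esum => x _; rewrite muleA -EFinM mulVf ?mul1e //; lra.
apply: le; first by rewrite invr_ge0; lra.
by move=> x; apply: mule_ge0 => //; rewrite lee_fin; lra.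
Qed.

Lemma normc_ofR (R : realType) (x : R) : normc x%:C%C = `|x|.
Proof. by rewrite /normc /= expr0n /= addr0 sqrtr_sqr. Qed.

Lemma normc_ge0 (R : realType) (x : R[i]) : 0 <= normc x.
Proof. by case: x => a b; exact: sqrtr_ge0. Qed.

Lemma swapK (T : Type) : involutive (@swap T).
Proof. by case. Qed.

Lemma len_swap (R : realType) (X : metricType R) (z : X * X) :
  len (swap z) = len z.
Proof. by rewrite /len /= metric_sym. Qed.

(** * Eigenvectors of [ds] and powers of its modulus *)

Section Spectrum.
Variables (R : realType) (X : metricType R) (M : spectral_geometry X).
Implicit Types (xi : section M) (T : operator M) (z b : X * X).

Definition fibre_sqnorm xi z : R := \sum_(k < mult M z) normc (xi z ord0 k) ^+ 2.

Lemma fibre_sqnorm_ge0 xi z : 0 <= fibre_sqnorm xi z.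
Proof. by apply: sumr_ge0 => k _; exact: sqr_ge0. Qed.

Lemma fibre_sqnorm0 xi z : xi z = 0 -> fibre_sqnorm xi z = 0.
Proof. by move=> xi0; apply: big1 => k _; rewrite xi0 mxE normc0 expr0n. Qed.

Lemma fibre_sqnorm_gt0 xi z : xi z <> 0 -> supp M z /\ 0 < fibre_sqnorm xi z.
Proof.
move=> /eqP/rV0Pn[k xik]; split.
  by apply/(mult_gt0 M); exact: leq_ltn_trans (ltn_ord k).
rewrite lt_neqAle fibre_sqnorm_ge0 andbT eq_sym psumr_eq0; last first.
  by move=> i _; exact: sqr_ge0.
apply/negP => /allP/(_ k (mem_index_enum _)) /=; rewrite sqrf_eq0 => /eqP.
by move=> /eq0_normc/eqP; exact/negP.
Qed.

Lemma sqnormE xi : sqnorm xi = \esum_(z in supp M) (fibre_sqnorm xi z)%:E.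
Proof. by []. Qed.

Lemma sqnorm_gt0 xi z : xi z <> 0 -> (0 < sqnorm xi)%E.
Proof.
move=> /fibre_sqnorm_gt0[Mz xi0].
apply: (@lt_le_trans _ _ (fibre_sqnorm xi z)%:E); first by rewrite lte_fin.
apply: esum_ge; exists [set z]; last by rewrite fsbig_set1.
by split; [exact: finite_set1|move=> _ ->].
Qed.

Lemma hilbert_finite_support xi (F : set (X * X)) :
  finite_set F -> (forall z, ~ F z -> xi z = 0) -> hilbert xi.
Proof.
move=> finF xiF; rewrite /hilbert /= sqnormE.
rewrite (esumID F); last by move=> z _; rewrite lee_fin fibre_sqnorm_ge0.
rewrite [X in (_ + X)%E]esum1 => [|z [_ /xiF/fibre_sqnorm0 -> //]].
rewrite adde0 esum_fset; last 2 first.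
- exact: finite_setIr.
- by move=> z _; rewrite lee_fin fibre_sqnorm_ge0.
by rewrite fsumEFin ?ltry //; exact: finite_setIr.
Qed.

Lemma sqnorm_scale xi (eta : section M) (c : R) :
  (forall z, eta z = c%:C%C *: xi z) -> sqnorm eta = ((c ^+ 2)%:E * sqnorm xi)%E.
Proof.
move=> etaE; rewrite !sqnormE -esumZl ?sqr_ge0 //; last first.
  by move=> z; rewrite lee_fin fibre_sqnorm_ge0.
apply: eq_esum => z _; rewrite -EFinM; congr EFin.
rewrite /fibre_sqnorm mulr_sumr; apply: eq_bigr => k _.
by rewrite etaE mxE normcM normc_ofR exprMn real_normK ?num_real.
Qed.

(** An eigenvector gives l^2 <= C, whence l <= C + 1. This bounds the sets whose suprema define
    [eigenvalue_seq]. *)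
Lemma eigenvalue_bounded T : bounded_linear T ->
  exists C : R, forall (l : R) xi z,
    eigenspace_at T l%:C%C xi -> xi z <> 0 -> l <= C.
Proof.
move=> [_ _ [C TC]]; exists (C + 1) => l xi z [hxi Txi] xiz.
have := TC xi hxi; rewrite (sqnorm_scale Txi).
have := sqnorm_gt0 xiz; have : (sqnorm xi < +oo)%E := hxi.
case: (sqnorm xi) => // r _; rewrite lte_fin => r0.
by rewrite -!EFinM lee_fin ler_pM2r //; nra.
Qed.

Definition mulop (f : X * X -> R) : operator M := fun xi z => (f z)%:C%C *: xi z.

Lemma mulop_bounded_linear (f : X * X -> R) (c : R) :
  0 <= c -> (forall z, supp M z -> 0 <= f z <= c) -> bounded_linear (mulop f).
Proof.
move=> c0 fc.
have bnd xi : (sqnorm (mulop f xi) <= (c ^+ 2)%:E * sqnorm xi)%E.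
  have <- : sqnorm (fun z => c%:C%C *: xi z : 'rV_(mult M z)) =
      ((c ^+ 2)%:E * sqnorm xi)%E by apply: sqnorm_scale.
  rewrite !sqnormE; apply: le_esum => z Mz; rewrite lee_fin; apply: ler_sum => k _.
  rewrite !mxE !normcM !normc_ofR; have /andP[f0 fzc] := fc z Mz.
  have := normc_ge0 (xi z ord0 k); rewrite !ger0_norm // => n0.
  by rewrite ler_sqr ?nnegrE ?mulr_ge0 // ler_wpM2r.
split.
- move=> xi hxi; apply: (le_lt_trans (bnd xi)).
  have : (sqnorm xi < +oo)%E := hxi.
  have : (0 <= sqnorm xi)%E.
    by apply: esum_ge0 => z _; rewrite lee_fin fibre_sqnorm_ge0.
  by case: (sqnorm xi) => // r _ _; rewrite -EFinM ltry.
- by move=> a xi eta _ _ z; rewrite /mulop scalerDr !scalerA mulrC.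
- by exists (c ^+ 2) => xi _; exact: bnd.
Qed.

(** The eigenvalue equations at [z] and [swap z] combine to len^2 v = lam^2 v, so an eigenvector
    lives on the pairs of length |lam|. *)
Lemma ds_eigenspace_len (lam : R[i]) xi z (k : 'I_(mult M z)) :
  eigenspace_at (@ds R X M) lam xi ->
  xi z ord0 k = 0 \/ normc lam = len z.
Proof.
case: z k => x y k [_ dsxi].
pose k' := cast_ord (esym (mult_sym M (x, y))) k.
have := congr1 (fun A : 'rV_(mult M (x, y)) => A ord0 k) (dsxi (x, y)).
have := congr1 (fun A : 'rV_(mult M (y, x)) => A ord0 k') (dsxi (y, x)).
rewrite /ds !mxE !castmxE /= !cast_ord_id.
have -> : cast_ord (esym (mult_sym M (y, x))) k' = k by exact: val_inj.
rewrite -[swap (y, x)]/(x, y) -[swap (x, y)]/(y, x).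
rewrite -[cast_ord (esym (mult_sym M (x, y))) k]/k'.
have -> : len (y, x) = len (x, y) by rewrite /len /= metric_sym.
move: (xi (x, y) ord0 k) (xi (y, x) ord0 k') => v w vw wv.
have [->|v0] := eqVneq v 0; [by left|right].
have : (len (x, y))%:C%C * (len (x, y))%:C%C = lam * lam.
  by apply: (mulIf v0); rewrite -mulrA vw mulrCA wv mulrA.
move=> /(congr1 (@normc R)); rewrite !normcM normc_ofR -!expr2.
rewrite (ger0_norm (mdist_ge0 _ _)) => /eqP.
by rewrite eqrXn2 ?normc_ge0 ?mdist_ge0 // => /eqP <-.
Qed.

(** Only finitely many pairs of the support have length at least 1; the sum of their lengths plus 1
    is a bound. *)
Lemma len_bounded : exists2 c : R, 0 <= c & forall z, supp M z -> len z <= c.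
Proof.
have /finite_seqP[s sE] := supp_finite M (@ltr01 R).
exists (1 + \sum_(b <- s) len b) => [|z Mz].
  by rewrite addr_ge0 // sumr_ge0 // => b _; exact: mdist_ge0.
have s0 : 0 <= \sum_(b <- s) len b by rewrite sumr_ge0 // => b _; exact: mdist_ge0.
have [z1|/ltW z1] := leP 1 (len z); last by lra.
have zs : z \in s by have : [set` s] z by rewrite -sE.
rewrite (perm_big _ (perm_to_rem zs)) big_cons /=.
have : 0 <= \sum_(b <- rem z s) len b by rewrite sumr_ge0 // => b _; exact: mdist_ge0.
by lra.
Qed.

Lemma is_abs_pow_mulop (p : R) : 0 <= p ->
  is_abs_pow (@ds R X M) p (mulop (fun z => len z `^ p)).
Proof.
move=> p0; have [c c0 lenc] := len_bounded; split.
  apply: (mulop_bounded_linear (c := c `^ p)) => [|z Mz]; first exact: powR_ge0.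
  rewrite powR_ge0 /= ge0_ler_powR ?nnegrE ?lenc //.
  exact: mdist_ge0.
move=> lam xi lamxi; split; first by case: lamxi.
move=> z; apply/rowP => k; rewrite !mxE.
by have [->|->] := ds_eigenspace_len k lamxi; rewrite ?mulr0.
Qed.

(** Multiplication by len^p is a candidate, so the choice in [abs_pow] does not fall back on
    [idfun]. *)
Lemma abs_powP (p : R) : 0 <= p ->
  is_abs_pow (@ds R X M) p (abs_pow (@ds R X M) p).
Proof.
move=> p0; apply: (@xgetPex _ _ [set T | is_abs_pow (@ds R X M) p T]).
by exists (mulop (fun z => len z `^ p)); exact: is_abs_pow_mulop.
Qed.

(** Constant along the fibre, hence compatible with the transport [castmx]; one eigenvector per pair
    suffices for a lower bound. *)
Definition delta_section b : section M := fun z => const_mx (z == b)%:R.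

(* On the span of the delta sections at b and swap b, ds is len b times the
   swap, so the symmetric and antisymmetric parts of the delta section at b are
   eigenvectors of ds with eigenvalues len b and - len b. *)
Lemma delta_eigenspace (p : R) T b : is_abs_pow (@ds R X M) p T ->
  eigenspace_at T (len b `^ p)%:C%C (delta_section b).
Proof.
move=> [[_ Tlin _] Tpow].
have Hfin : finite_set [set b; swap b] by exact: finite_set2.
pose g (e : R) : section M :=
  fun z => const_mx (((z == b)%:R + e%:C%C * (z == swap b)%:R) / 2).
have swapE z : (swap z == b) = (z == swap b).
  by apply/eqP/eqP => [<-|->]; rewrite swapK.
have swapE' z : (swap z == swap b) = (z == b).
  by rewrite -[RHS](inj_eq (can_inj (@swapK X))).
have g_eigen (e : R) : e ^+ 2 = 1 ->
    eigenspace_at T (len b `^ p)%:C%C (g e).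
  move=> e2.
  (* The eigenvalue of [ds] on [g e] is e|b|; its modulus is |b| as e = 1 or e = -1. *)
  have -> : len b = normc (e * len b)%:C%C.
    rewrite normc_ofR normrM (ger0_norm (mdist_ge0 _ _)).
    by have /eqP := e2; rewrite sqrf_eq1 => /orP[]/eqP->; rewrite ?normrN normr1 mul1r.
  apply: Tpow; split.
    apply: (hilbert_finite_support Hfin) => z /= zb; rewrite /g.
    have [zb1|_] := eqVneq z b; first by case: zb; left.
    have [zb2|_] := eqVneq z (swap b); first by case: zb; right.
    by rewrite mulr0 addr0 mul0r.
  move=> z; rewrite /ds /g castmx_const swapE swapE'.
  apply/rowP => k; rewrite !mxE.
  have E2 : e%:C%C * e%:C%C = 1 :> R[i] by rewrite -rmorphM -expr2 e2.
  have [zb|zb] : (z == b) || (z == swap b) \/ ~~ ((z == b) || (z == swap b)).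
    by case: orP; [left|right].
  - have -> : len z = len b by case/orP: zb => /eqP->; rewrite ?len_swap.
    rewrite rmorphM; move: E2; set E := e%:C%C => E2.
    by ring: E2.
  - move: zb; rewrite negb_or => /andP[/negbTE-> /negbTE->].
    by rewrite !(mulr0, addr0, mul0r).
have [g1 Tg1] := g_eigen 1 (expr1n _ _).
have [|g2 Tg2] := g_eigen (-1); first by rewrite sqrrN expr1n.
have dE : delta_section b = fun w => 1 *: g 1 w + g (-1) w.
  apply: functional_extensionality_dep => z; apply/rowP => k; rewrite !mxE.
  by rewrite rmorphN !rmorph1; field.
split.
  apply: (hilbert_finite_support Hfin) => z /= zb; rewrite /delta_section.
  by have [zb1|_] := eqVneq z b; first by case: zb; left.
move=> z; rewrite dE Tlin // Tg1 Tg2; apply/rowP => k; rewrite !mxE.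
by ring.
Qed.

End Spectrum.

(** * Lower bounds for the ordered eigenvalues *)

Lemma delta_lin_indep (R : realType) (X : metricType R) (M : spectral_geometry X)
    (n : nat) (b : 'I_n -> X * X) :
  injective b -> (forall i, supp M (b i)) ->
  lin_indep (fun i => @delta_section _ _ M (b i)).
Proof.
move=> binj Mb c c0 j; have mj : (0 < mult M (b j))%N by apply/mult_gt0.
have /rowP/(_ (Ordinal mj)) := c0 (b j).
rewrite summxE mxE (bigD1 j) //= big1 => [|i ij]; last first.
  by rewrite !mxE (inj_eq binj) eq_sym (negbTE ij) mulr0.
by rewrite !mxE eqxx mulr1 addr0.
Qed.

Lemma eigenvalue_seq_ge (R : realType) (X : metricType R) (M : spectral_geometry X)
    (p s : R) (T : operator M) (bs : seq (X * X)) (n : nat) :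
  0 <= p -> 0 <= s -> is_abs_pow (@ds R X M) p T ->
  uniq bs -> (forall b, b \in bs -> supp M b /\ s <= len b) ->
  (n < size bs)%N -> s `^ p <= eigenvalue_seq T n.
Proof.
move=> p0 s0 Tp ubs bsP nbs; apply: ub_le_sup; last first.
  split; first exact: powR_ge0.
  case E : bs nbs => [//|b0 bs'] nbs; rewrite -E in nbs.
  have ltb (i : 'I_n.+1) : (i < size bs)%N by exact: leq_trans (ltn_ord i) nbs.
  pose b (i : 'I_n.+1) := nth b0 bs i.
  have bP i := bsP (b i) (mem_nth _ (ltb i)).
  exists (fun i => len (b i) `^ p), (fun i => @delta_section _ _ M (b i)); split.
    move=> i; split; last exact: delta_eigenspace.
    have [_ sb] := bP i.
    by rewrite ge0_ler_powR // nnegrE // (le_trans s0 sb).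
  apply: delta_lin_indep => [i j /eqP|i]; last by have [] := bP i.
  by rewrite nth_uniq // => /eqP/val_inj.
(* [sup] dominates the members only of a bounded set. Each member is at most an eigenvalue whose
   eigenvector is nonzero by independence. *)
have [C CP] := eigenvalue_bounded Tp.1.
exists C => lam [lam0 [l [v [lv vind]]]].
have [laml eigl] := lv ord0; apply: le_trans laml _.
have [z vz] : exists z, v ord0 z <> 0.
  apply: contrapT => /forallNP v0.
  have : (ord0 == ord0 :> 'I_n.+1)%:R = 0 :> R[i].
    apply: (vind (fun i => (i == ord0)%:R)) => z.
    rewrite (bigD1 ord0) //= big1 => [|i /negbTE->]; last by rewrite scale0r.
    by have /contrapT -> := v0 z; rewrite scaler0 addr0.
  by move/eqP; rewrite eqxx oner_eq0.
exact: CP eigl vz.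
Qed.

Lemma sigma_ge (R : realType) (X : metricType R) (M : spectral_geometry X)
    (p s : R) (T : operator M) (bs : seq (X * X)) :
  0 <= p -> 0 <= s -> is_abs_pow (@ds R X M) p T ->
  uniq bs -> (forall b, b \in bs -> supp M b /\ s <= len b) ->
  (size bs)%:R * s `^ p <= sigma T (size bs).
Proof.
move=> p0 s0 Tp ubs bsP.
have -> : (size bs)%:R * s `^ p = \sum_(n < size bs) s `^ p.
  by rewrite sumr_const card_ord mulr_natl.
by apply: ler_sum => n _; exact: eigenvalue_seq_ge Tp ubs bsP _.
Qed.

(** * From the limits to single scales *)

Lemma covering_number_gt (R : realType) (X : metricType R) (q : R) :
  0 <= q -> (q%:E < upper_box_dimension X)%E -> forall e : R, 0 < e ->
  exists2 t : R, 0 < t < e &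
    forall n : nat, covers_by X t n -> expR (q * ln t^-1) <= n%:R.
Proof.
move=> q0 qX e e0; pose f (t : R) := (lne (covering_number X t) / (ln t^-1)%:E)%E.
(* Having t < 1 makes ln(1/t) positive, so the quotient can be cleared. *)
pose V := [set t : R | 0 < t < Num.min e 1].
have V0 : (0 : R)^'+ V.
  near=> t; rewrite /V /=; apply/andP; split; near: t.
    exact: nbhs_right_gt.
  by apply: nbhs_right_lt; rewrite lt_min e0 ltr01.
have : (q%:E < ereal_sup (f @` V))%E.
  by apply: (lt_le_trans qX); apply: ereal_inf_lbound; exists V.
move=> /ereal_sup_gt[_ [t /andP[t0 te] <-] qt]; move: te; rewrite lt_min => /andP[te t1].
exists t; first by rewrite t0.
have lt0 : 0 < ln t^-1 by rewrite ln_gt0 // invf_gt1.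
move=> n tn; have : (covering_number X t <= n%:R%:E)%E.
  by apply: ereal_inf_lbound; exists n.
move: qt; rewrite /f inver gt_eqF // lte_pdivlMr // -EFinM => qt cn.
have [c0|c0] := leP (covering_number X t) 0%E; first by move: qt; rewrite le0_lneNy.
have n0 : 0 < n%:R :> R by rewrite -lte_fin (lt_le_trans c0).
have : (lne (covering_number X t) <= lne n%:R%:E)%E.
  by rewrite lee_lne // in_itv /= leey ltW.
rewrite lne_EFin // => /(lt_le_trans qt); rewrite lte_fin => /ltW qn.
by rewrite -[leRHS]lnK ?posrE // ler_expR.
Unshelve. all: by end_near. Qed.

(** The infimum increases as t decreases, so its limit at 0 is a supremum and is beyond D already at
    one t. *)
Lemma local_density_gt (R : realType) (X : metricType R)
    (M : spectral_geometry X) (D : R) :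
  0 <= D -> (D%:E < local_density M)%E ->
  exists2 t : R, 0 < t & forall z : X * X, z.1 <> z.2 -> len z <= t ->
    exists2 b, supp M b & D * dist2 z b <= len z.
Proof.
move=> D0; rewrite /local_density; set f := fun t : R => ereal_inf _ => DM.
have fmono : {homo f : s t / s <= t >-> (t <= s)%E}.
  move=> s t st; apply: ereal_inf_le_tmp => _ [z [z12 zs] <-].
  by exists z => //; split=> //; exact: le_trans st.
have fcvg : f t @[t --> (0 : R)^'+] --> ereal_sup (f @` `]0, 1[).
  apply: (@nonincreasing_at_right_cvge _ _ 0 (BLeft 1)); first by rewrite bnd_simp.
  by move=> s t _ _; exact: fmono.
move: DM; rewrite (cvg_lim (@ereal_hausdorff R) fcvg) => /ereal_sup_gt[_ [t /= t01 <-] Dft].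
move: t01; rewrite in_itv /= => /andP[t0 _]; exists t => // z z12 zt.
have : (D%:E < ereal_sup ([set 0%E] `|` [set len_ratio z b | b in supp M]))%E.
  by apply: (lt_le_trans Dft); apply: ereal_inf_lbound; exists z.
move=> /ereal_sup_gt[_ [->|[b Mb <-]]]; first by rewrite lte_fin ltNge D0.
rewrite /len_ratio; case: eqVneq => [d0 _|d0].
  by exists b => //; rewrite d0 mulr0; exact: mdist_ge0.
have d_gt0 : 0 < dist2 z b by rewrite lt_neqAle eq_sym d0 le_max mdist_ge0.
by rewrite lte_fin ltr_pdivlMr // => /ltW Dz; exists b.
Qed.

(** * Comparison of the dimensions *)

Lemma dimension_ge (R : realType) (omega : (nat -> R) -> R) (X : metricType R)
    (M : spectral_geometry X) (p q : R) :
  compact [set: X] -> 0 <= p -> p < q -> (q%:E < upper_box_dimension X)%E ->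
  (10%:E < local_density M)%E -> (p%:E <= dimension omega M)%E.
Proof.
move=> cX p0 pq qX /local_density_gt[//|t0 t0_gt0 dense].
apply: ereal_sup_ubound; right; exists p => //; split=> //.
rewrite /dixmier_trace asboolF // => -[C logC].
have [K hK] := separated_size_bound cX t0_gt0.
have [U hU] := power_beats_log C K p0 pq.
(* The choice t < exp(-U) means ln(1/t) > U. *)
have [||t /andP[t_gt0 tU] ht] := covering_number_gt _ qX (e := expR (- U)).
- by lra.
- exact: expR_gt0.
have [s ss /ht] := separated_covers cX t_gt0.
have [bs [us [ubs bsP sus ->]]] := separated_support t_gt0 dense ss.
move=> qbs; have [||n1] := hU (ln t^-1) (size bs).
- by rewrite lnV ?posrE // ltrNr -ltr_expR lnK.
- by apply: (le_trans qbs); rewrite natrD lerD2l ler_nat hK.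
apply/negP; rewrite -leNgt.
have -> : expR (- (p * (ln t^-1 + ln 2))) = (t / 2) `^ p.
  rewrite /powR gt_eqF ?divr_gt0 //; congr expR.
  by rewrite lnM ?lnV ?posrE //; ring.
apply: (le_trans (sigma_ge p0 _ (abs_powP M p0) ubs bsP)); first by lra.
have ln0 : 0 < ln ((size bs)%:R : R) by rewrite ln_gt0.
rewrite -ler_pdivrMr //.
exact: le_trans (ler_norm _) (logC _).
Qed.

Theorem theorem4p15 (R : realType) (omega : (nat -> R) -> R)
    (homega : generalized_limit omega)
    (X : metricType R) (hX : compact [set: X]) :
  (upper_box_dimension X <= spectral_dimension omega X)%E.
Proof.
rewrite /spectral_dimension; set f := fun D : R => ereal_inf _.
(* Monotonicity makes the limit in D exist. *)
have fmono : {homo f : s t / s <= t >-> (s <= t)%E}.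
  move=> s t st; apply: ereal_inf_le_tmp => _ [M Ms <-].
  by exists M => //; apply: le_trans Ms; rewrite lee_fin.
have fcvg := nondecreasing_cvge fmono.
have f0 D : (0 <= f D)%E.
  by apply: le_ereal_inf_tmp => _ [M _ <-]; apply: ereal_sup_ubound; left.
have [U0|U0] := leP (upper_box_dimension X) 0.
  by apply: (le_trans U0); apply: lime_ge; [exact: cvgP fcvg|exact: nearW].
have main (p q : R) : 0 <= p -> p < q -> (q%:E < upper_box_dimension X)%E ->
    (p%:E <= lim (f D @[D --> +oo%R]))%E.
  move=> p0 pq qX; apply: lime_ge; first exact: cvgP fcvg.
  (* Any D > 10 puts all competing geometries within reach of [dimension_ge]. *)
  near=> D; apply: le_ereal_inf_tmp => _ [M DM <-].
  apply: (dimension_ge omega hX p0 pq qX); apply: lt_le_trans DM.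
  rewrite lte_fin; near: D; exact: nbhs_pinfty_gt.
rewrite leNgt; apply/negP => SU.
have S0 : (0 <= lim (f D @[D --> +oo%R]))%E.
  by apply: lime_ge; [exact: cvgP fcvg|exact: nearW].
case: (lim _) S0 SU main => [r|_|//]; last by rewrite ltNge leey.
rewrite lee_fin => r0; case: (upper_box_dimension X) => [u||//].
  rewrite lte_fin => ru main.
  suff : (2 * r + u) / 3 <= r by lra.
  (* If r < u, the points p and q at one and two thirds of the way from r to u give p <= r, a
     contradiction. *)
  by rewrite -lee_fin; apply: (main _ ((r + 2 * u) / 3)); rewrite ?lte_fin; lra.
move=> _ main; suff : r + 1 <= r by lra.
by rewrite -lee_fin; apply: (main _ (r + 2)); rewrite ?ltry //; lra.
Unshelve. all: by end_near. Qed.
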